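(* Let $T$ be a permutation tableau of length $n$, let $\pi=\xi(T)=\pi_1\pi_2\cdots\pi_n$, and let $\bar\pi=(n+1-\pi_n,\ldots,n+1-\pi_2,n+1-\pi_1)$ be the reverse complement of $\pi$. Then $$\mathrm{inv}(T)=f_{32\text{--}1}(\bar\pi).$$ Equivalently, $\mathrm{inv}(T)=f_{3\text{--}21}(\pi)$.
   Context: Permutation tableaux. Draw a Ferrers diagram in English convention: rows are left-justified, row lengths weakly decrease from top to bottom, and every column is nonempty. Rows of length zero are allowed. A permutation tableau $T$ is a filling of the cells of such a diagram with 0's and 1's satisfying two conditions: (i) every column contains at least one 1; (ii) no cell containing 0 has both a 1 above it in its column and a 1 to its left in its row. The length $n$ of $T$ is its number of rows plus its number of columns. Labels. The southeast boundary of the diagram is a lattice path of $n$ unit south/west steps from the top-right corner to the bottom-left corner. Its steps are labeled $1,\ldots,n$ in order. Each row gets the label of its south step (at the right end of the row), and each column gets the label of its west step (at the bottom of the column). Thus $[n]$ is partitioned into row labels and column labels. $(i,j)$ denotes the cell in the row labeled $i$ and the column labeled $j$. Zeros, ones and rows. A 1 is topmost if there is no 1 above it in its column. A 0 is restricted if there is a 1 above it in its column. A rightmost restricted 0 is a restricted 0 with no restricted 0 to its right in its row. A row is unrestricted if it contains no restricted 0; empty rows are unrestricted. Alternative representation and dots. Put a black dot on each topmost 1; there is exactly one per column. Put a white dot on each rightmost restricted 0; there is exactly one in each restricted row. A black dot is labeled by its column label, and a white dot by its row label. Alternating paths. The alternating path from a dot is a sequence of dots, identified with the sequence of their labels, built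 as follows. - From a white dot in cell $(i,j)$, the next dot is the black dot of column $j$. - From a black dot in cell $(i,j)$: if row $i$ is unrestricted, the path ends; otherwise the next dot is the white dot of row $i$. Every path therefore ends at a black dot in an unrestricted row. - If $k$ is a column label or the label of a restricted row, $P_k$ is the alternating path starting at the dot labeled $k$. - If $r$ is the label of an unrestricted row, $P_r$ is the empty path. We say $P_k$ is contained in a path $P$ if $k$ is the label of a dot of $P$; then $P_k$ is a final segment of $P$. An empty path $P_r$ is contained in no path. Order on paths. Let $a\neq b$ be labels such that neither of $P_a,P_b$ is contained in the other. Remove from $P_a$ and $P_b$ their longest common final segment (nothing is removed if they share no dot), obtaining $P'_a$ and $P'_b$. The ending position of $P'_a$ is defined as follows: - if $P'_a$ is nonempty, it is the cell of its last dot; - if $P_a$ is the empty path of an unrestricted row $r$, it is a point at the right end of row $r$, strictly to the right of all cells of that row. Define $P_a>P_b$ if the ending position of $P'_a$ lies in a row strictly below that of $P'_b$, or lies in the same row and strictly to the right. Otherwise $P_a<P_b$. Inversions. An inversion of $T$ is a pair $(j,k)$ of labels satisfying all of the following: $j$ is a column label; $j<k$; $k$ is not the label of a dot of $P_j$; and $P_j>P_k$. $\mathrm{inv}(T)$ is the number of inversions of $T$. The bijection $\xi$ (Corteel–Nadeau). Start with the labels of the unrestricted rows written in increasing order. Then process the column labels of $T$ in decreasing order. For a column $j$: 1. If its black dot is in cell $(i,j)$, insert $j$ immediately to the left of $i$. 2. If column $j$ contains white dots in rows $i_1<\cdots<i_k$, insert $i_1i_2\cdots i_k$, in this increasing order,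 immediately to the left of $j$. The final word is the permutation $\xi(T)$ of $[n]$. Dashed patterns. For a permutation $\sigma=\sigma_1\cdots\sigma_n$: - $f_{32\text{--}1}(\sigma)$ is the number of pairs $(a,b)$ with $a+1<b$ and $\sigma_a>\sigma_{a+1}>\sigma_b$; - $f_{3\text{--}21}(\sigma)$ is the number of pairs $(a,b)$ with $a<b<n$ and $\sigma_a>\sigma_b>\sigma_{b+1}$. *)

(* Defs.v *)
From mathcomp Require Import all_boot.
Set Implicit Arguments. Unset Strict Implicit. Unset Printing Implicit Defensive.

(* A diagram of length n is encoded by its southeast boundary path
   [p : seq bool] of size n, read from the top-right corner to the
   bottom-left corner: step k (label k, 1 <= k <= n) is [nth false p k.-1],
   [true] = south step (row label), [false] = west step (column label).
   Cell (i,j) exists iff i is a row label, j a column label and i < j.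
   In a row, a larger column label is further LEFT; in a column, a larger
   row label is further DOWN.  A filling is [f : nat -> nat -> bool]
   ([true] = 1), only consulted on cells. *)

Section Tableau.
Variables (p : seq bool) (f : nat -> nat -> bool).

Definition n_of := size p.
Definition labels := iota 1 n_of.

Definition isRow (k : nat) : bool := (1 <= k <= n_of) && nth false p k.-1.
Definition isCol (k : nat) : bool := (1 <= k <= n_of) && ~~ nth false p k.-1.
Definition cell (i j : nat) : bool := [&& isRow i, isCol j & i < j].

(* permutation tableau conditions (every column nonempty follows from (i)) *)
Definition is_perm_tableau : Prop :=
  (forall j, isCol j -> exists i, cell i j /\ f i j) /\
  (forall i j, cell i j -> f i j = false ->
     ~ ((exists i', [/\ cell i' j, i' < i & f i' j]) /\
        (exists j', [/\ cell i j', j < j' & f i j']))).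

Definition top (j : nat) : nat := head 0 [seq i <- labels | cell i j && f i j].

Definition restricted0 (i j : nat) : bool :=
  [&& cell i j, ~~ f i j & has (fun i' => [&& cell i' j, f i' j & i' < i]) labels].

Definition wdot (i : nat) : nat := head 0 [seq j <- labels | restricted0 i j].

Definition unrestrictedRow (i : nat) : bool := isRow i && ~~ has (restricted0 i) labels.
Definition restrictedRow (i : nat) : bool := isRow i && has (restricted0 i) labels.

(* alternating path from the black dot of column j, as the sequence of labels;
   the fuel n_of is sufficient since column labels strictly increase along it *)
Fixpoint pathB (fuel j : nat) : seq nat :=
  match fuel with
  | 0 => [::]
  | fuel'.+1 =>
      j :: (let t := top j in
            if unrestrictedRow t then [::] else t :: pathB fuel' (wdot t))
  end.

Definition P (k : nat) : seq nat :=
  if isCol k then pathB n_of k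
  else if restrictedRow k then k :: pathB n_of (wdot k)
  else [::].

Fixpoint dropcommon (s t : seq nat) : seq nat :=
  match s, t with
  | x :: s', y :: t' => if x == y then dropcommon s' t' else s
  | _, _ => s
  end.

Definition dotcell (k : nat) : nat * nat :=
  if isCol k then (top k, k) else (k, wdot k).

(* ending position of P'_a (w.r.t. b): (row, column key), where a smaller
   column key is further right; the right end of an empty row r is (r, 0),
   strictly right of all cells of row r (column labels are >= 1). *)
Definition endpos (a b : nat) : nat * nat :=
  if P a is [::] then (a, 0)
  else match dropcommon (rev (P a)) (rev (P b)) with
       | e :: _ => dotcell e   (* e = last dot of P'_a *)
       | [::] => (0, 0)        (* P_a contained in P_b: order undefined *)
       end.

Definition path_gt (a b : nat) : bool :=
  let (ra, ca) := endpos a b in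
  let (rb, cb) := endpos b a in
  (rb < ra) || ((ra == rb) && (ca < cb)).

Definition tab_inv : nat :=
  \sum_(j <- labels) \sum_(k <- labels)
     [&& isCol j, j < k, k \notin P j & path_gt j k].

Definition insert_before (xs : seq nat) (y : nat) (w : seq nat) : seq nat :=
  let k := index y w in take k w ++ xs ++ drop k w.

Definition xi_step (w : seq nat) (j : nat) : seq nat :=
  let w1 := insert_before [:: j] (top j) w in
  insert_before [seq i <- labels | restrictedRow i && (wdot i == j)] j w1.

Definition xi : seq nat :=
  foldl xi_step [seq i <- labels | unrestrictedRow i]
        (rev [seq j <- labels | isCol j]).

End Tableau.

(* dashed patterns, positions 0-indexed (paper's positions are 1-indexed) *)
Definition f_32_1 (s : seq nat) : nat :=
  \sum_(0 <= a < size s) \sum_(0 <= b < size s)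
     [&& a.+1 < b, nth 0 s a.+1 < nth 0 s a & nth 0 s b < nth 0 s a.+1].

Definition f_3_21 (s : seq nat) : nat :=
  \sum_(0 <= a < size s) \sum_(0 <= b < size s)
     [&& a < b, b.+1 < size s, nth 0 s b < nth 0 s a & nth 0 s b.+1 < nth 0 s b].

Definition rev_compl (n : nat) (s : seq nat) : seq nat :=
  [seq n.+1 - x | x <- rev s].

(* Main.v *)
(* The labels form a forest whose roots are the unrestricted rows, and the
   alternating path of k is its path to the root.  The insertion procedure
   defining xi writes the labels in postorder, the columns below a row being
   visited in decreasing order and the rows below a column in increasing order;
   comparing alternating paths amounts to comparing positions in that word.
   Hence inv counts the pairs (j,k) with j a column label, j < k and k left of j.
   Moreover the column labels are exactly the descent tops of the word, so that
   these pairs are the occurrences of 3-21. *)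
Require Import Defs.
From mathcomp Require Import all_boot.
From mathcomp Require Import zify.
Set Implicit Arguments. Unset Strict Implicit. Unset Printing Implicit Defensive.

(** * Postorder comparison of nodes given by their paths from the root *)

Section Postorder.
Variable c : nat -> bool.

(** The predicate [c] will be [isCol]: sibling columns are visited in decreasing order, sibling rows
    in increasing order. In the label forest siblings are never of mixed kind; that case only keeps
    the relation total. *)
Definition sibling_lt (x y : nat) : bool := if c x && c y then y < x else x < y.

(** An ancestor is a prefix, and postorder lists it after its descendants. *)
Fixpoint postlt (s t : seq nat) : bool :=
  match s, t with
  | x :: s', y :: t' => if x == y then postlt s' t' else sibling_lt x y
  | [::], _ => false
  | _ :: _, [::] => true
  end.

Lemma sibling_ltN x y : x != y -> sibling_lt y x = ~~ sibling_lt x y.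
Proof. by rewrite /sibling_lt [c y && _]andbC; case: ifP; case: ltngtP. Qed.

Lemma sibling_ltxx x : sibling_lt x x = false.
Proof. by rewrite /sibling_lt ltnn if_same. Qed.

Lemma postltN s t : s != t -> postlt t s = ~~ postlt s t.
Proof.
elim: s t => [|x s IH] [|y t] //=; rewrite eqseq_cons [y == x]eq_sym.
by case: eqVneq => [_|nxy _] /=; [apply: IH | apply: sibling_ltN].
Qed.

Lemma postltxx s : postlt s s = false.
Proof. by elim: s => //= x s; rewrite eqxx. Qed.

Lemma postlt_catl s t u : postlt s t -> postlt (s ++ u) t.
Proof. by elim: s t => [|x s IH] [|y t] //=; case: ifP => // _; apply: IH. Qed.

Lemma postlt_desc s x u : postlt (s ++ x :: u) s.
Proof. by elim: s => //= y s; rewrite eqxx. Qed.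

(** Either [s] branches off before the end of [t], and appending [x] changes nothing, or [s] lies
    below [t] through a child [y], which has to come before the new child [x]. *)
Lemma postlt_rcons s t x :
  postlt s t -> (forall y u, s = t ++ y :: u -> sibling_lt y x) ->
  postlt s (rcons t x).
Proof.
elim: s t => [|y s IH] [|z t] //=.
  by move=> _ /(_ y s erefl) yx; case: eqP yx => // ->; rewrite sibling_ltxx.
case: eqP => // -> st H; apply: IH => // y' u E; apply: (H y' u).
by rewrite E.
Qed.

Lemma postlt_siblings s x y : x != y ->
  postlt (rcons s x) (rcons s y) = sibling_lt x y.
Proof. by move=> nxy; elim: s => [|z s IH] /=; rewrite ?eqxx ?(negbTE nxy). Qed.

End Postorder.

Lemma insert_beforeE xs y w1 w2 :
  y \notin w1 -> insert_before xs y (w1 ++ y :: w2) = w1 ++ xs ++ y :: w2.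
Proof.
move=> yw; rewrite /insert_before index_cat (negbTE yw) /= eqxx addn0.
by rewrite take_size_cat // drop_size_cat.
Qed.

(** * Dots of the tableau and alternating paths *)

Section Tableau.
Variables (p : seq bool) (f : nat -> nat -> bool).
Hypothesis tabT : is_perm_tableau p f.

Notation labels := (labels p).
Notation isRow := (isRow p).
Notation isCol := (isCol p).
Notation cell := (cell p).
Notation top := (top p f).
Notation wdot := (wdot p f).
Notation restricted0 := (restricted0 p f).
Notation restrictedRow := (restrictedRow p f).
Notation unrestrictedRow := (unrestrictedRow p f).
Notation P := (P p f).

Lemma mem_labels k : (k \in labels) = isRow k || isCol k.
Proof.
rewrite mem_iota add1n ltnS /isRow /isCol /n_of.
by case: (_ <= _ <= _) => //=; case: nth.
Qed.

Lemma rowNcol k : isRow k -> isCol k = false.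
Proof. by rewrite /isRow /isCol => /andP[_ ->]; rewrite andbF. Qed.

Lemma colNrow k : isCol k -> isRow k = false.
Proof. by apply: contraTF => /rowNcol ->. Qed.

Lemma row_split k : isRow k = unrestrictedRow k || restrictedRow k.
Proof. by rewrite /unrestrictedRow /restrictedRow; case: isRow; case: has. Qed.

Lemma unrestricted_row r : unrestrictedRow r -> isRow r.
Proof. by case/andP. Qed.

Lemma restricted_row r : restrictedRow r -> isRow r.
Proof. by case/andP. Qed.

Lemma restrictedNunrestricted r : restrictedRow r -> unrestrictedRow r = false.
Proof. by rewrite /unrestrictedRow => /andP[-> ->]. Qed.

Lemma row_label k : isRow k -> k \in labels.
Proof. by rewrite mem_labels => ->. Qed.

Lemma col_label k : isCol k -> k \in labels.
Proof. by rewrite mem_labels orbC => ->. Qed.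

Lemma head_mem (x : nat) s : has predT s -> head x s \in s.
Proof. by case: s => //= a s _; rewrite inE eqxx. Qed.

Lemma top_cell j : isCol j -> cell (top j) j && f (top j) j.
Proof.
move=> /(proj1 tabT)[i [cij fij]].
have il : i \in labels by apply: row_label; case/and3P: cij.
have : top j \in [seq i <- labels | cell i j && f i j].
  apply: head_mem; apply/hasP; exists i => //.
  by rewrite mem_filter cij fij il.
by rewrite mem_filter => /andP[].
Qed.

Lemma top_row j : isCol j -> isRow (top j).
Proof. by move=> /top_cell/andP[/and3P[]]. Qed.

Lemma top_lt j : isCol j -> top j < j.
Proof. by move=> /top_cell/andP[/and3P[]]. Qed.

Lemma top_le i j : cell i j -> f i j -> top j <= i.
Proof.
move=> cij fij.
have il : i \in labels by apply: row_label; case/and3P: cij.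
have : i \in [seq i <- labels | cell i j && f i j] by rewrite mem_filter cij fij.
have : sorted ltn [seq i <- labels | cell i j && f i j].
  by apply: sorted_filter; [apply: ltn_trans | apply: iota_ltn_sorted].
rewrite /Defs.top; case: (filter _ _) => //= x s.
rewrite path_sortedE; last exact: ltn_trans.
by case/andP=> /allP H _; rewrite inE => /orP[/eqP->|/H/ltnW].
Qed.

Lemma wdot_restricted0 i : restrictedRow i -> restricted0 i (wdot i).
Proof.
move=> /andP[_ /hasP[j jl rj]].
have : wdot i \in [seq j <- labels | restricted0 i j].
  by apply: head_mem; apply/hasP; exists j => //; rewrite mem_filter rj.
by rewrite mem_filter => /andP[].
Qed.

Lemma wdot_col i : restrictedRow i -> isCol (wdot i).
Proof. by move=> /wdot_restricted0/and3P[/and3P[]]. Qed.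

Lemma lt_wdot i : restrictedRow i -> i < wdot i.
Proof. by move=> /wdot_restricted0/and3P[/and3P[]]. Qed.

Lemma top_wdot_lt i : restrictedRow i -> top (wdot i) < i.
Proof.
move=> /wdot_restricted0/and3P[_ _ /hasP[i' _ /and3P[ci' fi' li]]].
exact: leq_ltn_trans (top_le ci' fi') li.
Qed.

(* A restricted 0 has a 1 above it, hence no 1 to its left. *)
Lemma lt_wdot_top j : isCol j -> restrictedRow (top j) -> j < wdot (top j).
Proof.
move=> cj rt; have /andP[ct ft] := top_cell cj.
have /and3P[cw fw /hasP[i' _ /and3P[ci' fi' li]]] := wdot_restricted0 rt.
rewrite ltnNge leq_eqVlt; apply/negP => /orP[/eqP E|lt].
  by rewrite E ft in fw.
case: (proj2 tabT _ _ cw (negbTE fw)); split; first by exists i'.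
by exists j.
Qed.

(** Induction from the roots of the forest to its leaves. It is well founded because going from a
    column [j] to the column [wdot (top j)] strictly increases a label bounded by [n_of p]. *)
Lemma label_ind (Q : nat -> Prop) :
  (forall r, unrestrictedRow r -> Q r) ->
  (forall j, isCol j -> Q (top j) -> Q j) ->
  (forall i, restrictedRow i -> Q (wdot i) -> Q i) ->
  forall k, k \in labels -> Q k.
Proof.
move=> Qu Qc Qr.
have Qcol j : isCol j -> Q j.
  have [m] := ubnP (n_of p - j); elim: m j => // m IH j lem cj.
  apply: (Qc _ cj); have := top_row cj; rewrite row_split => /orP[/Qu//|rt].
  have lt := lt_wdot_top cj rt; have cw := wdot_col rt.
  apply: (Qr _ rt); apply: IH => //.
  by have /andP[/andP[_]] := cw; lia.
move=> k; rewrite mem_labels row_split -orbA => /or3P[/Qu//|rk|/Qcol//].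
by apply: (Qr _ rk); apply/Qcol/wdot_col.
Qed.

Lemma pathB_fuel m1 m2 j : isCol j -> n_of p - j < m1 -> n_of p - j < m2 ->
  pathB p f m1 j = pathB p f m2 j.
Proof.
elim: m1 m2 j => // m1 IH [//|m2] j cj l1 l2 /=; congr (_ :: _).
have := top_row cj; rewrite row_split; case: ifP => //= _ rt.
have lt := lt_wdot_top cj rt; have cw := wdot_col rt.
have /andP[/andP[_ ?] _] := cw.
by congr (_ :: _); apply: IH => //; lia.
Qed.

Lemma P_unrestricted r : unrestrictedRow r -> P r = [::].
Proof.
move=> ur; rewrite /Defs.P rowNcol ?unrestricted_row //.
by case: ifP => // /restrictedNunrestricted; rewrite ur.
Qed.

Lemma P_restricted i : restrictedRow i -> P i = i :: P (wdot i).
Proof.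
by move=> ri; rewrite /Defs.P (rowNcol (restricted_row ri)) ri wdot_col.
Qed.

Lemma P_col j : isCol j -> P j = j :: P (top j).
Proof.
move=> cj; rewrite {1}/Defs.P cj.
have jn : j <= n_of p by case/andP: cj => /andP[].
(* Labels start at 1, so the fuel left after one unfolding still exceeds the distance from the next
   column to [n_of p]. *)
have j0 : 0 < j by case/andP: cj => /andP[].
case En: (n_of p) => [|n]; first by lia.
rewrite /=; congr (_ :: _); have := top_row cj; rewrite row_split.
case: ifP => [ur _|_ /= rt]; first by rewrite P_unrestricted.
rewrite P_restricted //; have cw := wdot_col rt; rewrite /Defs.P cw.
have lt := lt_wdot_top cj rt; have /andP[/andP[_ ?] _] := cw.
by congr (_ :: _); apply: pathB_fuel => //; lia.
Qed.

Lemma P_self k : P k != [::] -> k \in labels -> k \in P k.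
Proof.
move=> Pk; rewrite mem_labels row_split -orbA => /or3P[ur|rk|ck].
- by rewrite P_unrestricted in Pk.
- by rewrite P_restricted // inE eqxx.
- by rewrite P_col // inE eqxx.
Qed.

(** Columns increase along a path. The stronger bound for rows carries the induction: from column
    [k] the path goes on to column [wdot (top k)], which exceeds [k]. *)
Lemma P_col_ge k j : k \in labels -> j \in P k -> isCol j ->
  (k <= j) && (isRow k ==> (wdot k <= j)).
Proof.
move=> + + cj; move: k; apply: label_ind => [r ur|k ck IH|i ri IH].
- by rewrite P_unrestricted.
- rewrite P_col // colNrow // andbT inE => /orP[/eqP->//|jP].
  have := top_row ck; rewrite row_split => /orP[ur|rt].
    by rewrite P_unrestricted in jP.
  have /andP[_] := IH jP; rewrite (restricted_row rt) /=.
  exact/leq_trans/ltnW/lt_wdot_top.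
- rewrite P_restricted // inE => /orP[/eqP E|/IH/andP[le _]].
    by rewrite E rowNcol ?restricted_row in cj.
  by rewrite le implybT andbT (leq_trans _ le) // ltnW // lt_wdot.
Qed.

(** * Paths from the root, and the order on alternating paths *)

Definition parent_of (x y : nat) : bool :=
  if isCol y then x == top y else restrictedRow y && (x == wdot y).

(** An alternating path lists dots only and so omits the unrestricted row where it ends. Putting
    that root in front separates the trees and gives roots a nonempty sequence. *)
Definition chain (k : nat) : seq nat :=
  (if P k is [::] then k else top (last 0 (P k))) :: rev (P k).

Lemma chain_unrestricted r : unrestrictedRow r -> chain r = [:: r].
Proof. by move=> ur; rewrite /chain P_unrestricted. Qed.

Lemma chain_col j : isCol j -> chain j = rcons (chain (top j)) j.
Proof.
move=> cj; rewrite /chain P_col // rev_cons /=; congr (_ :: _).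
by case: (P (top j)).
Qed.

Lemma chain_restricted i : restrictedRow i -> chain i = rcons (chain (wdot i)) i.
Proof.
by move=> ri; rewrite /chain P_restricted // rev_cons P_col // wdot_col.
Qed.

Lemma chainP k : k \in labels -> exists r,
  [/\ chain k = r :: rev (P k), unrestrictedRow r,
      path parent_of r (rev (P k)) & last r (rev (P k)) = k].
Proof.
move: k; apply: label_ind => [r ur|k ck [r [E ur pr lr]]|k rk [r [E ur pr lr]]].
- by exists r; rewrite chain_unrestricted // P_unrestricted.
- exists r; rewrite chain_col // E (P_col ck) rev_cons rcons_path last_rcons pr lr.
  by rewrite /parent_of ck eqxx.
- exists r; rewrite chain_restricted // E (P_restricted rk) rev_cons rcons_path.
  by rewrite last_rcons pr lr /parent_of rk eqxx rowNcol // restricted_row.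
Qed.

Lemma chain_last k : k \in labels -> last 0 (chain k) = k.
Proof. by move=> /chainP[r [-> _ _]]. Qed.

Lemma chain_inj : {in labels &, injective chain}.
Proof. by move=> a b la lb E; rewrite -(chain_last la) E chain_last. Qed.

Lemma chain_anc k j : j \in labels -> k \in P j -> exists u, chain j = chain k ++ u.
Proof.
move: j; apply: label_ind => [r ur|j cj IH|j rj IH].
- by rewrite P_unrestricted.
- rewrite P_col // inE => /orP[/eqP->|/IH[u E]]; first by exists [::]; rewrite cats0.
  by exists (rcons u j); rewrite chain_col // E rcons_cat.
- rewrite P_restricted // inE => /orP[/eqP->|/IH[u E]]; first by exists [::]; rewrite cats0.
  by exists (rcons u j); rewrite chain_restricted // E rcons_cat.
Qed.

Notation postlt := (postlt isCol).

Lemma parent_of_row r x : isRow r -> parent_of r x -> isCol x /\ r = top x.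
Proof.
rewrite /parent_of => rr; case: ifP => [_ /eqP//|_ /andP[rx /eqP E]].
by rewrite E colNrow // wdot_col in rr.
Qed.

(** [dropcommon] and [postlt] descend along the same two walks and stop at the same fork [y], so
    both are governed by the two children of [y] met there. *)
Lemma dropcommon_fork x s t :
  path parent_of x s -> path parent_of x t -> ~~ prefix s t -> ~~ prefix t s ->
  exists y e e' s' t', [/\ dropcommon s t = e :: s', dropcommon t s = e' :: t',
    parent_of y e && parent_of y e', e != e' & postlt t s = sibling_lt isCol e' e].
Proof.
elim: s x t => [|a s IH] x [|b t] //= /andP[xa ps] /andP[xb pt].
rewrite [b == a]eq_sym; case: eqVneq pt => [<-|nab] pt /=; first exact: IH ps pt.
by move=> _ _; exists x, a, b, s, t; rewrite xa xb.
Qed.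

(** The ending positions are the dots at the fork. Two rows below one column are compared by height,
    two columns below one row by position from left to right, where further right means a smaller
    label; this is exactly [sibling_lt]. *)
Lemma path_gtE a b : isCol a -> b \in labels -> a \notin P b -> b \notin P a ->
  path_gt p f a b = postlt (chain b) (chain a).
Proof.
move=> ca lb aPb bPa; have la := col_label ca.
have [ra [Ea ura pa _]] := chainP la.
have [rb [Eb urb pb lastb]] := chainP lb.
have Pa0 : P a != [::] by rewrite P_col.
have sPa : a \in rev (P a) by rewrite mem_rev P_self.
have npre : ~~ prefix (rev (P a)) (rev (P b)).
  apply/negP => /prefixP[u E]; case/negP: aPb.
  by rewrite -mem_rev E mem_cat sPa.
have endE k k' : P k != [::] -> endpos p f k k' =
    (if dropcommon (rev (P k)) (rev (P k')) is e :: _ then dotcell p f e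
     else (0, 0)).
  by rewrite /endpos; case: (P k).
have dotE r x : isRow r -> parent_of r x -> dotcell p f x = (r, x).
  by move=> rr /parent_of_row[] // cx ->; rewrite /dotcell cx.
rewrite /path_gt Ea Eb /= endE //.
have rowa := unrestricted_row ura; have rowb := unrestricted_row urb.
(* Here [b] is itself a root. Its column key 0 lies right of every cell, so the comparison comes
   down to whether its row is strictly above the root row of [a]. *)
have [Pb0|Pb0] := eqVneq (P b) [::].
  have Er : rb = b by rewrite -lastb Pb0.
  rewrite /endpos Pb0 /=; case: (rev (P a)) sPa pa => //= e s _ /andP[pe _].
  rewrite (dotE _ _ rowa pe) Er ltn0 andbF orbF.
  by case: eqVneq => [->|_]; rewrite ?ltnn // /sibling_lt -Er rowNcol.
rewrite endE //.
have npre' : ~~ prefix (rev (P b)) (rev (P a)).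
  apply/negP => /prefixP[u E]; case/negP: bPa.
  by rewrite -mem_rev E mem_cat mem_rev P_self.
have [Er|Nr] := eqVneq rb ra.
  rewrite Er in pb.
  have [y [e [e' [s' [t' [-> -> /andP[ye ye'] ne ->]]]]]] :=
    dropcommon_fork pa pb npre npre'.
  (* Two columns have their black dots in the common row [y]; two rows have their white dots in the
     common column [y]. The mixed cases would make [y] both a row and a column. *)
  move: ye ye'; rewrite /parent_of /dotcell /sibling_lt.
  case ce: (isCol e); case ce': (isCol e') => /=.
  - by move=> /eqP<- /eqP<-; rewrite ltnn eqxx.
  - move=> /eqP E /andP[re' /eqP E'].
    by have := rowNcol (top_row ce); rewrite -E E' wdot_col.
  - move=> /andP[re' /eqP E'] /eqP E.
    by have := rowNcol (top_row ce'); rewrite -E E' wdot_col.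
  - by rewrite (negbTE ne) orbF.
(* With distinct roots, both ending positions are black dots in the root rows, and the rows
   decide. *)
have Pb0' : rev (P b) != [::] by rewrite -size_eq0 size_rev size_eq0.
case: (rev (P a)) sPa pa => //= e s _ /andP[pe _].
case: (rev (P b)) Pb0' pb => //= e' t _ /andP[pe' _].
have ne : e != e'.
  apply: contraNneq Nr => E.
  have [_ ->] := parent_of_row rowb pe'.
  by have [_ ->] := parent_of_row rowa pe; rewrite E.
rewrite [e' == e]eq_sym (negbTE ne) (dotE _ _ rowa pe) (dotE _ _ rowb pe').
by rewrite [ra == rb]eq_sym (negbTE Nr) orbF /sibling_lt rowNcol.
Qed.

(** * The invariant of the insertion procedure *)

Definition placed (s : seq nat) (x : nat) : bool :=
  [|| unrestrictedRow x, isCol x && (x \in s) | restrictedRow x && (wdot x \in s)].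

(* A word sorted for this relation that ends with a row label has exactly the
   column labels as descent tops. *)
Definition step_lt (u v : nat) : bool := if isCol u then v < u else u < v.

Definition before (x y : nat) : bool := postlt (chain x) (chain y).

Definition word_inv (s w : seq nat) : Prop :=
  [/\ pairwise before w, sorted step_lt w, ~~ isCol (last 0 w) & w =i placed s].

(** Membership in [placed] reflects that a restricted row enters together with the column of its
    white dot. *)
Lemma placed_label s x : placed s x -> x \in labels.
Proof.
rewrite mem_labels row_split.
by case/or3P=> [->//|/andP[-> _]|/andP[-> _]]; rewrite !orbT.
Qed.

Lemma mem_chain_col k y : k \in labels -> isCol y -> y \in chain k -> y \in P k.
Proof.
move=> /chainP[r [-> ur _ _]] cy; rewrite inE mem_rev => /orP[/eqP E|//].
by rewrite E (rowNcol (unrestricted_row ur)) in cy.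
Qed.

Lemma chain_parent k x y v : k \in labels -> x \in labels ->
  chain k = chain x ++ y :: v -> parent_of x y.
Proof.
move=> /chainP[r [-> _ pr _]] /chainP[r' [-> _ _ lr']] [Er E].
by move: pr; rewrite E Er cat_path /= lr' => /and3P[].
Qed.

Lemma path_step_lt_rows j i w x R :
  ~~ isCol x -> x < j -> all (predC isCol) R -> all (ltn^~ j) R ->
  path ltn x R -> isCol j -> i < j -> path step_lt i w ->
  path step_lt x (R ++ j :: i :: w).
Proof.
elim: R x => [|y R IH] x cx xj /= aR aj pR cj ij pw; rewrite {1}/step_lt (negbTE cx).
  by rewrite xj /step_lt cj ij.
case/andP: aR aj pR => cy aR /andP[yj aj] /andP[-> pR] /=.
exact: IH.
Qed.

(** The columns of [s] are those larger than [j]. Hence [j] is so far the last child of [i = top j],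
    and its place is just before [i]; the rows below [j] precede it, with nothing yet below them. *)
Lemma word_inv_step s j w :
  isCol j -> j \notin s -> {in s, forall x, isCol x && (j < x)} ->
  (forall x, isCol x -> j < x -> x \in s) ->
  word_inv s w -> word_inv (j :: s) (xi_step p f w j).
Proof.
move=> cj js sj sj' [pw sw lw mw].
pose i := top j; have rowi : isRow i := top_row cj.
have ij : i < j := top_lt cj.
(* The row [i] is a root, or its white dot lies in a column larger than [j], already processed. *)
have iw : i \in w.
  rewrite mw; change (placed s i); rewrite /placed.
  move: (rowi); rewrite row_split => /orP[->//|ri].
  have ji := lt_wdot_top cj ri.
  by rewrite ri (sj' (wdot i)) ?orbT // wdot_col.
have jw : j \notin w.
  rewrite mw; change (~~ placed s j); rewrite /placed (negbTE js) andbF.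
  by rewrite /unrestrictedRow /restrictedRow colNrow.
have lab x : x \in w -> x \in labels.
  by rewrite mw; apply: placed_label.
have colw x : x \in w -> isCol x -> j < x.
  rewrite mw => /or3P[/unrestricted_row/rowNcol->//|/andP[_ /sj/andP[]]//|].
  by case/andP=> /restricted_row/rowNcol->.
(* In particular no label of [w] descends from [j]. *)
have colP x y : x \in w -> isCol y -> y \in P x -> j < y.
  move=> xw cy yP; have := P_col_ge (lab _ xw) yP cy.
  case/andP=> xy wy; move: xw; rewrite mw => /or3P[ux|/andP[_ /sj/andP[_ jx]]|].
  - by rewrite P_unrestricted in yP.
  - exact: leq_trans jx xy.
  - case/andP=> rx /sj/andP[_ jx]; rewrite restricted_row // in wy.
    exact: leq_trans jx wy.
have uw : uniq w.
  by apply: (pairwise_uniq _ pw) => x; rewrite /before postltxx.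
pose R := [seq i <- labels | restrictedRow i && (wdot i == j)].
have RP x : x \in R = restrictedRow x && (wdot x == j).
  rewrite mem_filter; case: (boolP (restrictedRow x)) => //= rx.
  by rewrite row_label ?andbT // restricted_row.
have Ri x : x \in R -> i < x < j.
  by rewrite RP => /andP[rx /eqP E]; rewrite -E lt_wdot // /i -E top_wdot_lt.
have cR : all (predC isCol) R.
  by apply/allP => x; rewrite RP /= => /andP[/restricted_row/rowNcol->].
have sR : sorted ltn R.
  by apply: sorted_filter; [apply: ltn_trans | apply: iota_ltn_sorted].
case/splitPr: w / iw pw sw lw mw jw lab colw colP uw => w1 w2.
move=> pw sw lw mw jw lab colw colP uw.
have iw1 : i \notin w1.
  by move: uw; rewrite cat_uniq /= negb_or => /and3P[_ /andP[]].
have jw1 : j \notin w1 by move: jw; rewrite mem_cat negb_or => /andP[].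
have -> : xi_step p f (w1 ++ i :: w2) j = w1 ++ R ++ j :: i :: w2.
  by rewrite /xi_step -/i insert_beforeE //= insert_beforeE.
have chj : chain j = rcons (chain i) j by apply: chain_col.
have chR x : x \in R -> chain x = rcons (chain j) x.
  by rewrite RP => /andP[rx /eqP <-]; apply: chain_restricted.
have w1w x : x \in w1 -> x \in w1 ++ i :: w2 by rewrite mem_cat => ->.
have ji : before j i by rewrite /before chj -cats1 postlt_desc.
have b1i : {in w1, forall u, before u i}.
  move=> u u1; move: pw; rewrite pairwise_cat => /and3P[/allrelP H _ _].
  by apply: H; rewrite ?inE ?eqxx.
(* If [u] lies below [i], it does so through a column [y] larger than [j], an earlier sibling of
   [j]. *)
have b1j : {in w1, forall u, before u j}.
  move=> u u1; rewrite /before chj; apply: postlt_rcons; first exact: b1i.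
  move=> y v E; have ul := lab _ (w1w _ u1).
  have cy : isCol y.
    by have [] := parent_of_row rowi (chain_parent ul (row_label rowi) E).
  have jy : j < y.
    by apply: (colP u) => //; [exact: w1w|
       apply: mem_chain_col => //; rewrite E mem_cat mem_head orbT].
  by rewrite /sibling_lt cy cj jy.
(* The only obstruction would be a [u] below [j], which [colP] excludes. *)
have b1R : {in w1 & R, forall u x, before u x}.
  move=> u x u1 xR; rewrite /before (chR _ xR); apply: postlt_rcons; first exact: b1j.
  move=> y v E; have ul := lab _ (w1w _ u1).
  have : j \in P u.
    apply: mem_chain_col => //.
    by rewrite E mem_cat chj mem_rcons inE eqxx.
  by move=> /(colP _ _ (w1w _ u1) cj); rewrite ltnn.
have bj2 : {in w2, forall v, before j v}.
  move=> v v2; rewrite /before chj -cats1; apply: postlt_catl.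
  move: pw; rewrite pairwise_cat /= => /and4P[_ _ /allP H _].
  exact: H.
split.
- move: pw; rewrite !pairwise_cat /= => /and4P[/allrelP p12 -> /allP pi2 ->].
  rewrite andTb !andbT; apply/and4P; split.
  + apply/allrelP => u x u1; rewrite mem_cat !inE => /or4P[|/eqP->|/eqP->|x2].
    * exact: b1R.
    * exact: b1j.
    * exact: b1i.
    * by apply: p12; rewrite // inE x2 orbT.
  + apply/allrelP => x v xR; rewrite !inE /before (chR _ xR) -cats1.
    case/or3P=> [/eqP->|/eqP->|v2]; first exact: postlt_desc.
      exact: postlt_catl.
    exact/postlt_catl/bj2.
  + move: sR; rewrite sorted_pairwise; last exact: ltn_trans.
    apply: sub_in_pairwise (allss R) => x y xR yR /= xy.
    rewrite /before (chR _ xR) (chR _ yR) postlt_siblings ?neq_ltn ?xy //.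
    by rewrite /sibling_lt (negbTE (allP cR _ xR)).
  + by rewrite ji /=; apply/andP; split; apply/allP.
- move: sw; rewrite sorted_cat_cons => /andP[+ p2].
  have sRj : sorted step_lt (R ++ j :: i :: w2).
    have aR : all (ltn^~ j) R by apply/allP => x /Ri/andP[].
    case: (R) cR aR sR => [|x R'] /=; first by rewrite /step_lt cj ij.
    case/andP=> cx cR' /andP[xj aR'] pR'; exact: path_step_lt_rows.
  (* The last entry [u] of the left part used to be followed by [i]. The first inserted label is
     larger than [i] and at most [j]: a row [u] stays below it, and a column [u] exceeds [j], hence
     it. *)
  case/lastP: w1 {b1j b1i b1R pw lw mw jw iw1 jw1 lab uw colP} w1w colw => [//|w1 u] w1w colw.
  rewrite -!cats1 -!catA /= !sorted_cat_cons /= => /andP[-> /andP[ui _]] /=.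
  have uj : isCol u -> j < u by apply: colw; rewrite w1w // mem_rcons inE eqxx.
  case: (R) Ri cR sRj => [_ _ /= -> |x R' /(_ x (mem_head _ _))/andP[ix xj] _ /= ->];
    move: ui uj; rewrite /step_lt; case: ifP => _ ui uj; rewrite andbT.
  + exact: uj.
  + exact: ltn_trans ij.
  + exact: ltn_trans (uj _).
  + exact: ltn_trans ix.
- by move: lw; rewrite !last_cat.
- move=> x; have := mw x; rewrite mem_cat inE.
  change (x \in placed (j :: s)) with (placed (j :: s) x).
  change (x \in placed s) with (placed s x).
  rewrite /placed !mem_cat !inE RP.
  have [->|_] := eqVneq x j; first by rewrite cj !orbT.
  rewrite !orFb andb_orr => /esym E; rewrite orbCA -E orbCA.
  by congr (_ || _); apply: orbCA.
Qed.

Lemma word_inv0 : word_inv [::] [seq i <- labels | unrestrictedRow i].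
Proof.
have sl : sorted ltn [seq i <- labels | unrestrictedRow i].
  by apply: sorted_filter; [apply: ltn_trans | apply: iota_ltn_sorted].
have al : all unrestrictedRow [seq i <- labels | unrestrictedRow i].
  exact: filter_all.
split.
- move: sl; rewrite sorted_pairwise; last exact: ltn_trans.
  apply: sub_in_pairwise al => x y ux uy /= xy.
  rewrite /before !chain_unrestricted // -[[:: x]]/(rcons [::] x).
  rewrite (postlt_siblings _ [::]) ?neq_ltn ?xy //.
  by rewrite /sibling_lt rowNcol // unrestricted_row.
- apply: (sub_in_sorted _ al sl) => x y ux uy /= xy.
  by rewrite /step_lt rowNcol // unrestricted_row.
- case/lastP: (filter _ _) al => [|w x] //=.
  by rewrite all_rcons last_rcons => /andP[/unrestricted_row/rowNcol->].
- move=> x; rewrite -[x \in placed _]/(placed [::] x) /placed !in_nil !andbF orbF.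
  rewrite mem_filter; case: (boolP (unrestrictedRow x)) => //= ux.
  by rewrite row_label // unrestricted_row.
Qed.

(** Columns are processed in decreasing order, so those already treated form a suffix of the
    increasing list. *)
Lemma word_inv_suffix s t : [seq j <- labels | isCol j] = t ++ s ->
  word_inv s (foldr (fun j w => xi_step p f w j)
                    [seq i <- labels | unrestrictedRow i] s).
Proof.
elim: s t => [|j s IH] t E /=; first exact: word_inv0.
have sl : sorted ltn (t ++ j :: s).
  by rewrite -E; apply: sorted_filter; [apply: ltn_trans | apply: iota_ltn_sorted].
have colE x : isCol x = (x \in t ++ j :: s).
  rewrite -E mem_filter; case: (boolP (isCol x)) => //= cx.
  by rewrite col_label.
move: sl; rewrite sorted_pairwise ?pairwise_cat; last exact: ltn_trans.
case/and3P=> /allrelP tlt _ /=; case/andP => /allP js _.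
apply: word_inv_step.
- by rewrite colE mem_cat mem_head orbT.
- by apply/negP => /js /=; rewrite ltnn.
- by move=> x xs; rewrite colE mem_cat inE xs !orbT; apply: js.
- move=> x; rewrite colE mem_cat inE => /or3P[xt|/eqP->|//].
    by have /= := tlt x j xt (mem_head _ _); case: ltngtP.
  by rewrite ltnn.
- by apply: (IH (rcons t j)); rewrite cat_rcons.
Qed.

(** * Reading the inversions off the final word *)

Lemma xi_inv : word_inv [seq j <- labels | isCol j] (xi p f).
Proof. by rewrite /xi foldl_rev; apply: (@word_inv_suffix _ [::]). Qed.

Lemma mem_xi : xi p f =i labels.
Proof.
move=> x; have [_ _ _ ->] := xi_inv.
rewrite -[x \in placed _]/(placed [seq j <- labels | isCol j] x) /placed.
rewrite mem_labels row_split mem_filter.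
case: (boolP (isCol x)) => cx /=; first by rewrite col_label // !orbT.
rewrite orbF; case: (boolP (restrictedRow x)) => //= rx.
by rewrite mem_filter wdot_col // col_label // wdot_col.
Qed.

Lemma xi_uniq : uniq (xi p f).
Proof.
have [pw _ _ _] := xi_inv.
by apply: (pairwise_uniq _ pw) => x; rewrite /before postltxx.
Qed.

Lemma perm_xi : perm_eq (xi p f) labels.
Proof. exact: (uniq_perm xi_uniq (iota_uniq _ _) mem_xi). Qed.

(** The word is sorted for [before]; since this relation is total and antisymmetric on distinct
    labels, sortedness becomes an equivalence. *)
Lemma before_index x y : x \in labels -> y \in labels -> x != y ->
  before x y = (index x (xi p f) < index y (xi p f)).
Proof.
rewrite -!mem_xi => lx ly nxy; have [/(pairwiseP 0) pw _ _ _] := xi_inv.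
have lt_before u v : u \in xi p f -> v \in xi p f ->
    index u (xi p f) < index v (xi p f) -> before u v.
  move=> lu lv uv; rewrite -(nth_index 0 lu) -(nth_index 0 lv).
  by apply: pw; rewrite ?inE ?index_mem.
case: ltngtP => [/lt_before->//|/lt_before lt|E].
  rewrite /before postltN; first by rewrite -/(before y x) lt.
  by rewrite (inj_in_eq chain_inj) -?mem_xi // eq_sym.
by rewrite -(nth_index 0 lx) E nth_index ?eqxx in nxy.
Qed.

(** If [k] is an ancestor of [j], it stands to the right of [j] and both sides are false. Otherwise
    the paths are comparable: [j] is not on the path of [k], whose columns are all at least [k]. *)
Lemma inversionE j k : j \in labels -> k \in labels ->
  [&& isCol j, j < k, k \notin P j & path_gt p f j k] =
  [&& isCol j, j < k & index k (xi p f) < index j (xi p f)].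
Proof.
move=> lj lk; case: (boolP (isCol j)) => //= cj; case: ltnP => //= jk.
have njk : k != j by rewrite neq_ltn jk orbT.
rewrite -before_index //; case: (boolP (k \in P j)) => kP /=.
  have [[|x u] E] := chain_anc lj kP.
    by rewrite cats0 in E; rewrite (chain_inj lj lk E) eqxx in njk.
  rewrite /before postltN; first by rewrite E postlt_desc.
  by apply: contraNneq njk => /chain_inj->.
rewrite path_gtE //; apply/negP => jP.
by have := P_col_ge lk jP cj; rewrite leqNgt jk.
Qed.

Lemma col_descent b : b < size (xi p f) ->
  isCol (nth 0 (xi p f) b) =
  (b.+1 < size (xi p f)) && (nth 0 (xi p f) b.+1 < nth 0 (xi p f) b).
Proof.
move=> lb; have [_ /(sortedP 0) sw lw _] := xi_inv.
case: ltnP => [lt|le] /=.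
  by have := sw _ lt; rewrite /step_lt; case: ifP => // _; case: ltngtP.
have -> : b = (size (xi p f)).-1 by lia.
by rewrite nth_last (negbTE lw).
Qed.

Lemma tab_inv_xi : tab_inv p f = f_3_21 (xi p f).
Proof.
transitivity (\sum_(j <- xi p f) \sum_(k <- xi p f)
    [&& isCol j, j < k & index k (xi p f) < index j (xi p f)]).
  rewrite /tab_inv (perm_big _ perm_xi) /= [LHS]big_seq [RHS]big_seq.
  apply: eq_bigr => j lj; rewrite (perm_big _ perm_xi) /= [LHS]big_seq [RHS]big_seq.
  by apply: eq_bigr => k lk; rewrite inversionE.
(* The label [j] at position [b] plays the 2 and [k] at position [a] the 3; being a column supplies
   the 1 right after [j]. *)
rewrite /f_3_21 exchange_big_nat /= (big_nth 0) big_nat [RHS]big_nat.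
apply: eq_bigr => b lb; rewrite (big_nth 0) big_nat [RHS]big_nat.
apply: eq_bigr => a la; congr nat_of_bool.
rewrite !index_uniq ?xi_uniq // col_descent //.
by case: (b.+1 < _); case: (_ < _); case: (_ < _); case: (a < b).
Qed.

End Tableau.

(** Reversing 32-1 gives 1-23, whose complement is 3-21. The bound by [n] keeps the truncated
    subtraction strictly decreasing on the entries. *)
Lemma f_32_1_rev_compl n s : all (leq^~ n) s ->
  f_32_1 (rev_compl n s) = f_3_21 s.
Proof.
move=> /allP sn; rewrite /f_32_1 /f_3_21 size_map size_rev.
set m := size s.
have nthE a : a < m -> nth 0 (rev_compl n s) a = n.+1 - nth 0 s (m - a.+1).
  by move=> am; rewrite (nth_map 0) ?size_rev // nth_rev.
have le a : a < m -> nth 0 s a <= n by move=> am; apply/sn/mem_nth.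
rewrite exchange_big_nat big_nat_rev [LHS]big_nat [RHS]big_nat /=.
apply: eq_bigr => a am; rewrite add0n.
case Em : m am => [|m'] // am.
(* An adjacent pair starts at one of the first [m - 1] positions. The final term of each inner sum
   vanishes and is removed, so that reversal acts on the starting positions alone. *)
rewrite !big_nat_recr //= ltnn andbF addn0.
have -> : (m'.+1 < m'.+1 - a.+1) = false by lia.
rewrite addn0.
rewrite big_nat_rev [LHS]big_nat [RHS]big_nat /=.
apply: eq_bigr => b bm; rewrite add0n; congr nat_of_bool.
rewrite !nthE ?Em; try lia.
have -> : m'.+1 - (m'.+1 - a.+1).+1 = a by lia.
have -> : m'.+1 - (m' - b.+1).+1 = b.+1 by lia.
have -> : m'.+1 - (m' - b.+1).+2 = b by lia.
have := le a; have := le b; have := le b.+1; rewrite Em; lia.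
Qed.

Theorem theorem2p1 (p : seq bool) (f : nat -> nat -> bool) :
  is_perm_tableau p f ->
  tab_inv p f = f_32_1 (rev_compl (size p) (xi p f)) /\
  tab_inv p f = f_3_21 (xi p f).
Proof.
move=> tabT; rewrite f_32_1_rev_compl ?tab_inv_xi //.
by apply/allP => x; rewrite mem_xi // mem_iota add1n ltnS => /andP[].
Qed.
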